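(* Fix an integer $d\geq 2$. Let $\gamma_d$ be the epicycloid \[ \gamma_d=\left\{ \frac{e^{id\theta}-de^{i\theta}}{d+1} : \theta\in[0,2\pi]\right\}\subset\overline{\mathbb{D}}. \] Then the relative boundary of $\widetilde{\mathcal{E}_d}$ in $\overline{\mathbb{D}}$ is the epicycloid $\gamma_d$.
   Context: $\mathbb{D}$ denotes the open unit disk. For $w\in\mathbb{D}$ let $B_w(z)=\left(\frac{z-w}{1-\overline{w}z}\right)^d$, a unicritical Blaschke product of degree $d$. By the Denjoy–Wolff theorem, a finite Blaschke product $B$ of degree at least $2$ has a unique point $z_0\in\overline{\mathbb{D}}$ (its Denjoy–Wolff point) such that $B^n(z)\to z_0$ for every $z\in\mathbb{D}$. $B$ is called elliptic if $z_0\in\mathbb{D}$; hyperbolic if $z_0\in\partial\mathbb{D}$ and $B'(z_0)<1$; parabolic if $z_0\in\partial\mathbb{D}$ and $B'(z_0)=1$. Let $S_d=\{w\in\mathbb{D}:\arg(w)\in[0,\tfrac{2\pi}{d-1})\}$, let $\mathcal{E}_d=\{w\in S_d: B_w \text{ is elliptic}\}$, and let $\widetilde{\mathcal{E}_d}=\bigcup_{j=0}^{d-2}R_j(\mathcal{E}_d)\subset\mathbb{D}$, where $R_j$ is the rotation of the plane about $0$ through angle $2\pi j/(d-1)$. *)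

(* Defs.v *)
From Stdlib Require Import Reals.
From Coquelicot Require Import Coquelicot.
Open Scope R_scope.

Definition cis (t : R) : C := (cos t, sin t).

Definition in_disk (z : C) : Prop := Cmod z < 1.
Definition in_cdisk (z : C) : Prop := Cmod z <= 1.

Definition blaschke (d : nat) (w : C) (z : C) : C :=
  Cpow (Cdiv (Cminus z w) (Cminus 1 (Cmult (Cconj w) z))) d.

Definition iterate (f : C -> C) (n : nat) (z : C) : C := Nat.iter n f z.

Definition is_DW_point (f : C -> C) (z0 : C) : Prop :=
  in_cdisk z0 /\
  forall z, in_disk z ->
    filterlim (fun n => iterate f n z) eventually (locally z0).

Definition elliptic (f : C -> C) : Prop :=
  exists z0, is_DW_point f z0 /\ in_disk z0.

(* arg(w) in [0, 2pi/(d-1)) : w = r e^{i theta}, r >= 0, theta in that range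
   (convention: w = 0 has argument 0). *)
Definition S_d (d : nat) (w : C) : Prop :=
  in_disk w /\
  exists r t, 0 <= r /\ 0 <= t < 2 * PI / INR (d - 1) /\ w = Cmult (RtoC r) (cis t).

Definition E_d (d : nat) (w : C) : Prop := S_d d w /\ elliptic (blaschke d w).

Definition rot (d j : nat) (z : C) : C := Cmult (cis (2 * PI * INR j / INR (d - 1))) z.

Definition Etilde (d : nat) (w : C) : Prop :=
  exists j : nat, (j <= d - 2)%nat /\ exists u, E_d d u /\ w = rot d j u.

Definition rel_boundary_cdisk (A : C -> Prop) (p : C) : Prop :=
  in_cdisk p /\
  forall eps : R, 0 < eps ->
    (exists q, A q /\ in_cdisk q /\ Cmod (Cminus q p) < eps) /\
    (exists q, in_cdisk q /\ ~ A q /\ Cmod (Cminus q p) < eps).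

Definition epicycloid (d : nat) (p : C) : Prop :=
  exists t, 0 <= t <= 2 * PI /\
    p = Cdiv (Cminus (cis (INR d * t)) (Cmult (RtoC (INR d)) (cis t))) (RtoC (INR d + 1)).

(* Main.v *)
Require Import Defs.
From Stdlib Require Import Reals Lra Lia Psatz ClassicalEpsilon.
From Coquelicot Require Import Coquelicot.

(** Write [B_w = P o M] with [M z = (z - w) / (1 - conj w z)] and [P u = u^d].
    The fixed points of [B_w] correspond to those of [M o P], and for [|w| < 1]
    the equation [M (u^d) = u] with [|u| < 1] can be solved for [w]:
    [w = phi u = (u^d - u (1 + ... + |u|^(2(d-1)))) / (1 + ... + |u|^(2d))].
    Thus [phi] maps the open disk onto the elliptic parameters, it is continuous
    on the closed disk, and on the unit circle it parametrizes the epicycloid.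
    By Cauchy-Schwarz, [u -> u^d] contracts the pseudo-hyperbolic distance by a
    definite amount.  Hence an interior fixed point attracts the whole disk, it
    persists when [w] is perturbed (so [phi] of the open disk is open), and it
    excludes a boundary fixed point of multiplier 1 (so that image misses the
    epicycloid). *)

Open Scope R_scope.

(** * Squared moduli and the denominator [1 - Cconj v * u] *)

Definition nsq (z : C) : R := Cmod z ^ 2.

Lemma nsq_coord (z : C) : nsq z = fst z * fst z + snd z * snd z.
Proof. unfold nsq. rewrite Cmod2_alt. unfold Re, Im. ring. Qed.

Lemma nsq_conj_mult (z : C) : RtoC (nsq z) = (z * Cconj z)%C.
Proof. unfold nsq. rewrite RtoC_pow, <- Cmod2_conj, RtoC_pow. reflexivity. Qed.

Lemma nsq_ge_0 (z : C) : 0 <= nsq z.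
Proof. apply pow2_ge_0. Qed.

Lemma nsq_mult (x y : C) : nsq (x * y) = nsq x * nsq y.
Proof. unfold nsq. rewrite Cmod_mult. ring. Qed.

Lemma nsq_conj (z : C) : nsq (Cconj z) = nsq z.
Proof. unfold nsq. now rewrite Cmod_conj. Qed.

Lemma nsq_pow (z : C) (n : nat) : nsq (z ^ n)%C = nsq z ^ n.
Proof. unfold nsq. rewrite Cmod_pow, <- !pow_mult. f_equal. lia. Qed.

Lemma nsq_eq_0 (z : C) : nsq z = 0 -> z = 0.
Proof. intros H. apply Cmod_eq_0. unfold nsq in H. pose proof (Cmod_ge_0 z). nra. Qed.

Lemma nsq_gt_0 (z : C) : z <> 0 -> 0 < nsq z.
Proof.
  intros H. destruct (nsq_ge_0 z) as [h|h]; [exact h|].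
  exfalso. apply H, nsq_eq_0. now symmetry.
Qed.

Lemma nsq_lt_1 (z : C) : nsq z < 1 <-> Cmod z < 1.
Proof. unfold nsq. pose proof (Cmod_ge_0 z). split; intros; nra. Qed.

Lemma nsq_one_sub_le_4 (u v : C) :
  nsq u <= 1 -> nsq v <= 1 -> nsq (1 - Cconj v * u)%C <= 4.
Proof.
  unfold nsq. intros Hu Hv. pose proof (Cmod_ge_0 u). pose proof (Cmod_ge_0 v).
  pose proof (Cmod_triangle 1 (- (Cconj v * u))) as T.
  change (1 + - (Cconj v * u))%C with (1 - Cconj v * u)%C in T.
  rewrite Cmod_opp, Cmod_mult, Cmod_conj, Cmod_1 in T.
  pose proof (Cmod_ge_0 (1 - Cconj v * u)%C).
  assert (Cmod u <= 1) by nra. assert (Cmod v <= 1) by nra. nra.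
Qed.

(** Both sides expand to [1 - 2 Re (conj v u) + |u|^2 |v|^2]. The identity converts statements on
    the pseudo-hyperbolic distance into statements on the factors [1 - nsq]. *)
Lemma nsq_one_sub (u v : C) :
  nsq (1 - Cconj v * u)%C = (1 - nsq u) * (1 - nsq v) + nsq (u - v)%C.
Proof. destruct u as [a b], v as [p q]. rewrite !nsq_coord; simpl. ring. Qed.

Lemma one_sub_neq_0 (u v : C) :
  Cmod u <= 1 -> Cmod v < 1 -> (1 - Cconj v * u)%C <> 0.
Proof.
  intros Hu Hv H.
  assert (E : Cmod (Cconj v * u)%C = 1).
  { replace (Cconj v * u)%C with (RtoC 1); [apply Cmod_1|].
    replace (RtoC 1) with ((1 - Cconj v * u) + Cconj v * u)%C by ring.
    rewrite H. ring. }
  rewrite Cmod_mult, Cmod_conj in E.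
  pose proof (Cmod_ge_0 u); pose proof (Cmod_ge_0 v). nra.
Qed.

(** * Geometric sums and their Cauchy-Schwarz inequality *)

(** A sum instead of the quotient [(1 - x^n) / (1 - x)], so that [x = 1] is allowed; this is what
    lets [phi] extend to the unit circle. *)
Fixpoint geoR (n : nat) (x : R) : R :=
  match n with O => 0 | S k => geoR k x + x ^ k end.

Fixpoint geoC (n : nat) (x : C) : C :=
  match n with O => 0 | S k => (geoC k x + x ^ k)%C end.

Lemma geoR_telescope (n : nat) (x : R) : geoR n x * (1 - x) = 1 - x ^ n.
Proof. induction n as [|n IH]; simpl; [ring|]. rewrite Rmult_plus_distr_r, IH. ring. Qed.

Lemma geoC_telescope (n : nat) (x : C) : (geoC n x * (1 - x) = 1 - x ^ n)%C.
Proof.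
  induction n as [|n IH]; cbn [geoC Cpow]; [ring|]. rewrite Cmult_plus_distr_r, IH. ring.
Qed.

Lemma geoR_S (n : nat) (x : R) : geoR (S n) x = 1 + x * geoR n x.
Proof. induction n as [|n IH]; simpl in *; [ring|]. rewrite Rmult_plus_distr_l. lra. Qed.

Lemma geoR_ge_0 (n : nat) (x : R) : 0 <= x -> 0 <= geoR n x.
Proof. intros H. induction n; simpl; [lra|]. pose proof (pow_le x n H). lra. Qed.

Lemma geoR_ge_1 (n : nat) (x : R) : 0 <= x -> 1 <= geoR (S n) x.
Proof. intros H. rewrite geoR_S. pose proof (geoR_ge_0 n x H). nra. Qed.

Lemma geoR_1 (n : nat) : geoR n 1 = INR n.
Proof. induction n as [|n IH]; [reflexivity|]. rewrite S_INR. simpl. rewrite IH, pow1. ring. Qed.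

Lemma geoR_le (n : nat) (x : R) : 0 <= x <= 1 -> geoR n x <= INR n.
Proof.
  intros H. induction n as [|n IH]; [simpl; lra|]. rewrite S_INR. simpl.
  pose proof (pow_incr x 1 n H) as E. rewrite pow1 in E. lra.
Qed.

(* Cauchy-Schwarz for the vectors (u^k) and (v^k), k < d, keeping from
   Lagrange's identity only the minor of the indices 0 and 1. *)
Lemma geo_cauchy_schwarz (n : nat) (u v : C) :
  nsq (geoC (S (S n)) (Cconj v * u)) + nsq (u - v)%C
  <= geoR (S (S n)) (nsq u) * geoR (S (S n)) (nsq v).
Proof.
  induction n as [|n IH].
  (* With two terms there is only one minor, so equality holds. *)
  - destruct u as [a b], v as [p q]. simpl. rewrite !nsq_coord; simpl.
    apply Req_le. ring.
  - set (m := S (S n)) in *.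
    change (geoC (S m) (Cconj v * u)) with
      (geoC m (Cconj v * u) + (Cconj v * u) ^ m)%C.
    change (geoR (S m) (nsq u)) with (geoR m (nsq u) + nsq u ^ m).
    change (geoR (S m) (nsq v)) with (geoR m (nsq v) + nsq v ^ m).
    assert (Hz : nsq ((Cconj v * u) ^ m)%C = nsq u ^ m * nsq v ^ m).
    { rewrite nsq_pow, nsq_mult, nsq_conj, Rpow_mult_distr. ring. }
    pose proof (geoR_ge_0 m _ (nsq_ge_0 u)) as HA.
    pose proof (geoR_ge_0 m _ (nsq_ge_0 v)) as HB.
    pose proof (pow_le _ m (nsq_ge_0 u)) as Ha.
    pose proof (pow_le _ m (nsq_ge_0 v)) as Hb.
    pose proof (nsq_ge_0 (u - v)%C) as HD.
    set (Z := geoC m (Cconj v * u)) in *. set (z := ((Cconj v * u) ^ m)%C) in *.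
    set (A := geoR m (nsq u)) in *. set (B := geoR m (nsq v)) in *.
    set (a := nsq u ^ m) in *. set (b := nsq v ^ m) in *.
    set (D := nsq (u - v)%C) in *. clearbody Z z A B a b D.
    (* The cross term satisfies [2 |Z| |z| <= 2 sqrt (A B a b) <= A b + B a], by the induction
       hypothesis (with [D >= 0] dropped) and the arithmetic-geometric mean inequality. *)
    assert (Hc : nsq (Z + z)%C <= nsq Z + nsq z + (A * b + B * a)).
    { unfold nsq in Hz, IH |- *.
      pose proof (Cmod_triangle Z z). pose proof (Cmod_ge_0 Z).
      pose proof (Cmod_ge_0 z). pose proof (Cmod_ge_0 (Z + z)%C).
      assert (Cmod (Z + z)%C ^ 2 <= (Cmod Z + Cmod z) ^ 2) by (apply pow_incr; lra).
      assert (2 * (Cmod Z * Cmod z) <= A * b + B * a).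
      { apply Rsqr_incr_0_var; [|nra]. unfold Rsqr.
        assert ((Cmod Z * Cmod z) * (Cmod Z * Cmod z) <= (A * B) * (a * b)).
        { replace ((Cmod Z * Cmod z) * (Cmod Z * Cmod z))
            with (Cmod Z ^ 2 * Cmod z ^ 2) by ring.
          rewrite Hz. apply Rmult_le_compat_r; [nra|lra]. }
        assert (0 <= (A * b - B * a) * (A * b - B * a)) by apply Rle_0_sqr.
        nra. }
      nra. }
    nra.
Qed.

(** * Möbius maps of the disk *)

Definition mob (w x : C) : C := ((x - w) / (1 - Cconj w * x))%C.

(** With [mob_one_sub] this gives the invariance of [phd]: both expressions gain the factor
    [1 - nsq w], and their denominators differ only by a conjugation, which does not affect
    moduli. *)
Lemma mob_sub (w x y : C) : Cmod w < 1 -> Cmod x <= 1 -> Cmod y <= 1 ->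
  (mob w x - mob w y = (x - y) * (1 - RtoC (nsq w)) /
     ((1 - Cconj w * x) * (1 - Cconj w * y)))%C.
Proof.
  intros Hw Hx Hy. pose proof (one_sub_neq_0 x w Hx Hw). pose proof (one_sub_neq_0 y w Hy Hw).
  rewrite nsq_conj_mult. unfold mob. field. tauto.
Qed.

Lemma mob_one_sub (w x y : C) : Cmod w < 1 -> Cmod x <= 1 -> Cmod y <= 1 ->
  (1 - Cconj (mob w y) * mob w x = (1 - Cconj y * x) * (1 - RtoC (nsq w)) /
     ((1 - Cconj w * x) * Cconj (1 - Cconj w * y)))%C.
Proof.
  intros Hw Hx Hy. pose proof (one_sub_neq_0 x w Hx Hw).
  pose proof (one_sub_neq_0 y w Hy Hw) as H1.
  assert (H2 : Cconj (1 - Cconj w * y)%C <> 0).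
  { intros E. apply H1. rewrite <- (Cconj_conj (1 - Cconj w * y)%C), E.
    unfold Cconj; simpl. unfold RtoC. f_equal. ring. }
  rewrite nsq_conj_mult. unfold mob. rewrite Cdiv_conj by exact H1.
  rewrite !Cminus_conj, !Cmult_conj, Cconj_conj in *.
  replace (Cconj 1) with (RtoC 1) in * by (unfold Cconj, RtoC; simpl; f_equal; ring).
  field. tauto.
Qed.

Lemma nsq_div (x y : C) : y <> 0 -> nsq (x / y)%C = nsq x / nsq y.
Proof.
  intros H. unfold nsq. rewrite Cmod_div by exact H.
  pose proof (proj1 (Cmod_gt_0 y) H). field. lra.
Qed.

Lemma nsq_one_sub_RtoC (w : C) : nsq (1 - RtoC (nsq w))%C = (1 - nsq w) ^ 2.
Proof. rewrite nsq_coord. unfold RtoC; simpl. ring. Qed.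

Lemma nsq_mob_sub (w x y : C) : Cmod w < 1 -> Cmod x <= 1 -> Cmod y <= 1 ->
  nsq (mob w x - mob w y)%C = nsq (x - y)%C * (1 - nsq w) ^ 2 /
    (nsq (1 - Cconj w * x)%C * nsq (1 - Cconj w * y)%C).
Proof.
  intros Hw Hx Hy. rewrite mob_sub, nsq_div by
    (auto; apply Cmult_neq_0; now apply one_sub_neq_0).
  now rewrite !nsq_mult, nsq_one_sub_RtoC.
Qed.

Lemma nsq_mob_one_sub (w x y : C) : Cmod w < 1 -> Cmod x <= 1 -> Cmod y <= 1 ->
  nsq (1 - Cconj (mob w y) * mob w x)%C =
    nsq (1 - Cconj y * x)%C * (1 - nsq w) ^ 2 /
    (nsq (1 - Cconj w * x)%C * nsq (1 - Cconj w * y)%C).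
Proof.
  intros Hw Hx Hy.
  assert (H2 : Cconj (1 - Cconj w * y)%C <> 0).
  { apply Cmod_gt_0. rewrite Cmod_conj. apply Cmod_gt_0. now apply one_sub_neq_0. }
  rewrite mob_one_sub, nsq_div; try assumption;
    [|apply Cmult_neq_0; [now apply one_sub_neq_0 | exact H2]].
  now rewrite !nsq_mult, nsq_one_sub_RtoC, nsq_conj.
Qed.

Lemma one_sub_nsq_mob (w x : C) : Cmod w < 1 -> Cmod x <= 1 ->
  1 - nsq (mob w x) = (1 - nsq w) * (1 - nsq x) / nsq (1 - Cconj w * x)%C.
Proof.
  intros Hw Hx. pose proof (one_sub_neq_0 x w Hx Hw) as H.
  unfold mob. rewrite nsq_div by exact H. pose proof (nsq_gt_0 _ H).
  pose proof (nsq_one_sub x w). 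
  apply (Rmult_eq_reg_r (nsq (1 - Cconj w * x)%C)); [|lra].
  field_simplify; lra.
Qed.

Lemma Cmod_mob_lt_1 (w x : C) : Cmod w < 1 -> Cmod x < 1 -> Cmod (mob w x) < 1.
Proof.
  intros Hw Hx. apply nsq_lt_1.
  enough (0 < 1 - nsq (mob w x)) by lra.
  rewrite one_sub_nsq_mob by lra.
  pose proof (nsq_gt_0 _ (one_sub_neq_0 x w (Rlt_le _ _ Hx) Hw)).
  apply Rdiv_lt_0_compat; [|assumption].
  pose proof (proj2 (nsq_lt_1 w) Hw). pose proof (proj2 (nsq_lt_1 x) Hx). nra.
Qed.

(** * Pseudo-hyperbolic distance and its contraction by powers *)

(* Square of the pseudo-hyperbolic distance. *)
Definition phd (u v : C) : R := nsq (u - v)%C / nsq (1 - Cconj v * u)%C.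

Lemma nsq_one_sub_gt_0 (u v : C) :
  Cmod u < 1 -> Cmod v < 1 -> 0 < nsq (1 - Cconj v * u)%C.
Proof. intros Hu Hv. apply nsq_gt_0, one_sub_neq_0; lra. Qed.

Lemma phd_ge_0 (u v : C) : Cmod u < 1 -> Cmod v < 1 -> 0 <= phd u v.
Proof.
  intros Hu Hv. apply Rmult_le_pos; [apply nsq_ge_0|].
  apply Rlt_le, Rinv_0_lt_compat. now apply nsq_one_sub_gt_0.
Qed.

Lemma one_sub_phd (u v : C) : Cmod u < 1 -> Cmod v < 1 ->
  1 - phd u v = (1 - nsq u) * (1 - nsq v) / nsq (1 - Cconj v * u)%C.
Proof.
  intros Hu Hv. pose proof (nsq_one_sub_gt_0 u v Hu Hv).
  pose proof (nsq_one_sub u v). unfold phd.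
  apply (Rmult_eq_reg_r (nsq (1 - Cconj v * u)%C)); [|lra].
  field_simplify; lra.
Qed.

Lemma nsq_sub_phd (u v : C) : Cmod u < 1 -> Cmod v < 1 ->
  nsq (u - v)%C = phd u v * nsq (1 - Cconj v * u)%C.
Proof.
  intros Hu Hv. pose proof (nsq_one_sub_gt_0 u v Hu Hv). unfold phd. field. lra.
Qed.

Lemma nsq_sub_le (u v : C) : Cmod u < 1 -> Cmod v < 1 ->
  nsq (u - v)%C <= 4 * phd u v.
Proof.
  intros Hu Hv. rewrite nsq_sub_phd by assumption.
  pose proof (phd_ge_0 u v Hu Hv). apply nsq_lt_1 in Hu, Hv.
  pose proof (nsq_one_sub_le_4 u v (Rlt_le _ _ Hu) (Rlt_le _ _ Hv)). nra.
Qed.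

Lemma phd_mob (w x y : C) : Cmod w < 1 -> Cmod x < 1 -> Cmod y < 1 ->
  phd (mob w x) (mob w y) = phd x y.
Proof.
  intros Hw Hx Hy. unfold phd.
  rewrite nsq_mob_sub, nsq_mob_one_sub by lra.
  pose proof (nsq_one_sub_gt_0 x y Hx Hy). pose proof (nsq_one_sub_gt_0 x w Hx Hw).
  pose proof (nsq_one_sub_gt_0 y w Hy Hw). apply nsq_lt_1 in Hw.
  field. repeat split; lra.
Qed.

Lemma Cmod_pow_lt_1 (n : nat) (u : C) : Cmod u < 1 -> Cmod (u ^ S n)%C < 1.
Proof.
  intros Hu. rewrite Cmod_pow. pose proof (Cmod_ge_0 u).
  simpl. pose proof (pow_incr _ 1 n (conj H (Rlt_le _ _ Hu))) as E. rewrite pow1 in E.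
  pose proof (pow_le _ n H). nra.
Qed.

(** A Schwarz-Pick inequality with an explicit gain. Telescoping gives [1 - phd (u^d) (v^d) = (1 -
    phd u v) * (A * B / Z)] with geometric sums [A], [B], [Z]; Cauchy-Schwarz gives
    [A * B >= Z + nsq (u - v)], and [Z <= d^2]. *)
Lemma phd_pow (n : nat) (u v : C) : Cmod u < 1 -> Cmod v < 1 ->
  phd (u ^ S (S n)) (v ^ S (S n)) <=
  phd u v - (1 - phd u v) * (nsq (u - v)%C / INR (S (S n)) ^ 2).
Proof.
  intros Hu Hv. set (d := S (S n)).
  assert (Hu' : Cmod (u ^ d)%C < 1) by now apply Cmod_pow_lt_1.
  assert (Hv' : Cmod (v ^ d)%C < 1) by now apply Cmod_pow_lt_1.
  pose proof (one_sub_phd _ _ Hu' Hv') as E'.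
  pose proof (one_sub_phd u v Hu Hv) as E.
  pose proof (nsq_one_sub_gt_0 u v Hu Hv) as P.
  pose proof (nsq_one_sub_gt_0 _ _ Hu' Hv') as P'.
  pose proof (geo_cauchy_schwarz n u v) as CS. fold d in CS.
  assert (F : nsq (1 - Cconj (v ^ d) * u ^ d)%C =
              nsq (geoC d (Cconj v * u)) * nsq (1 - Cconj v * u)%C).
  { rewrite <- nsq_mult, geoC_telescope, Cpow_conj, Cpow_mult_l. reflexivity. }
  rewrite F in P', E'. rewrite !nsq_pow, <- !geoR_telescope in E'.
  apply nsq_lt_1 in Hu, Hv.
  pose proof (nsq_ge_0 u). pose proof (nsq_ge_0 v).
  assert (G1 : geoR d (nsq u) <= INR d) by (apply geoR_le; lra).
  assert (G2 : geoR d (nsq v) <= INR d) by (apply geoR_le; lra).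
  pose proof (geoR_ge_0 d _ (nsq_ge_0 u)). pose proof (geoR_ge_0 d _ (nsq_ge_0 v)).
  pose proof (nsq_ge_0 (u - v)%C) as HD.
  assert (Hd : 0 < INR d) by (apply lt_0_INR; unfold d; lia).
  set (Z := nsq (geoC d (Cconj v * u))) in *.
  assert (HZ : 0 < Z).
  { destruct (nsq_ge_0 (geoC d (Cconj v * u))) as [h|h]; [exact h|].
    unfold Z in P'. rewrite <- h in P'. lra. }
  assert (HZd : Z <= INR d ^ 2) by nra.
  set (A := geoR d (nsq u)) in *. set (B := geoR d (nsq v)) in *.
  assert (Q0 : 0 <= 1 - phd u v).
  { rewrite E. apply Rmult_le_pos; [nra|]. now apply Rlt_le, Rinv_0_lt_compat. }
  assert (EE : 1 - phd (u ^ d) (v ^ d) = (1 - phd u v) * (A * B / Z)).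
  { rewrite E', E. field. lra. }
  assert (L : 1 + nsq (u - v)%C / INR d ^ 2 <= A * B / Z).
  { apply Rle_trans with (1 + nsq (u - v)%C / Z).
    - apply Rplus_le_compat_l, Rmult_le_compat_l; [exact HD|].
      now apply Rinv_le_contravar.
    - apply (Rmult_le_reg_r Z); [exact HZ|].
      replace ((1 + nsq (u - v)%C / Z) * Z) with (Z + nsq (u - v)%C) by (field; lra).
      replace (A * B / Z * Z) with (A * B) by (field; lra). exact CS. }
  nra.
Qed.

Lemma phd_lt_1 (u v : C) : Cmod u < 1 -> Cmod v < 1 -> phd u v < 1.
Proof.
  intros Hu Hv. enough (0 < 1 - phd u v) by lra. rewrite one_sub_phd by assumption.
  pose proof (nsq_one_sub_gt_0 u v Hu Hv). apply nsq_lt_1 in Hu, Hv.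
  apply Rdiv_lt_0_compat; nra.
Qed.

Lemma phd_pow_le (n : nat) (u v : C) : Cmod u < 1 -> Cmod v < 1 ->
  phd (u ^ S (S n)) (v ^ S (S n)) <= phd u v.
Proof.
  intros Hu Hv. pose proof (phd_pow n u v Hu Hv). pose proof (phd_lt_1 u v Hu Hv).
  assert (0 <= nsq (u - v)%C / INR (S (S n)) ^ 2).
  { apply Rmult_le_pos; [apply nsq_ge_0|]. apply Rlt_le, Rinv_0_lt_compat, pow_lt.
    apply lt_0_INR. lia. }
  nra.
Qed.

(** On a compact disk the additive gain of [phd_pow] becomes a multiple of [phd u v], since
    [nsq (u - v)] is [phd u v] times a factor bounded below. *)
Lemma phd_pow_contract (n : nat) (s : R) : 0 < s < 1 ->
  exists k, 0 < k < 1 /\ forall u v, s <= 1 - nsq u -> s <= 1 - nsq v ->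
    phd (u ^ S (S n)) (v ^ S (S n)) <= k * phd u v.
Proof.
  intros Hs. set (D := INR (S (S n)) ^ 2).
  assert (HD : 4 <= D).
  { unfold D. rewrite !S_INR. pose proof (pos_INR n). nra. }
  (* Product of the lower bound [s^2 / 4] for [1 - phd u v] and the lower bound [s^2 / D] for the
     ratio of [nsq (u - v) / D] to [phd u v]. *)
  set (t := s * s * (s * s) / (4 * D)).
  assert (Ht : 0 < t < 1).
  { assert (0 < s * s < 1) by nra. assert (0 < s * s * (s * s) < 1) by nra. split.
    - apply Rdiv_lt_0_compat; lra.
    - apply (Rmult_lt_reg_r (4 * D)); [lra|]. unfold t, Rdiv.
      rewrite Rmult_assoc, Rinv_l; lra. }
  exists (1 - t). split; [lra|]. intros u v Su Sv.
  assert (Hu : Cmod u < 1) by (apply nsq_lt_1; lra).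
  assert (Hv : Cmod v < 1) by (apply nsq_lt_1; lra).
  pose proof (phd_pow n u v Hu Hv) as P. fold D in P.
  pose proof (phd_ge_0 u v Hu Hv) as H0.
  pose proof (nsq_sub_phd u v Hu Hv) as HN.
  pose proof (nsq_one_sub u v) as HI. pose proof (nsq_ge_0 (u - v)%C) as HG.
  pose proof (one_sub_phd u v Hu Hv) as HQ.
  pose proof (nsq_one_sub_gt_0 u v Hu Hv) as HP.
  assert (H4 : nsq (1 - Cconj v * u)%C <= 4) by
    (apply nsq_one_sub_le_4; lra).
  set (X := nsq (1 - Cconj v * u)%C) in *. set (e := phd u v) in *.
  assert (HX : s * s <= X) by nra.
  assert (HQ' : s * s / 4 <= 1 - e).
  { rewrite HQ. apply Rmult_le_compat; [nra| lra | nra |].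
    now apply Rinv_le_contravar. }
  assert (e * (s * s) / D <= nsq (u - v)%C / D).
  { apply Rmult_le_compat_r; [apply Rlt_le, Rinv_0_lt_compat; lra|]. nra. }
  assert (t * e = s * s / 4 * (e * (s * s) / D)) by (unfold t; field; lra).
  assert (0 <= e * (s * s) / D).
  { apply Rmult_le_pos; [nra|]. apply Rlt_le, Rinv_0_lt_compat; lra. }
  assert (s * s / 4 * (e * (s * s) / D) <= (1 - e) * (nsq (u - v)%C / D)).
  { apply Rmult_le_compat; try assumption. nra. }
  lra.
Qed.

Lemma Cmod_one_sub_ge (u v : C) : 1 - Cmod v * Cmod u <= Cmod (1 - Cconj v * u)%C.
Proof.
  pose proof (Cmod_triangle (1 - Cconj v * u) (Cconj v * u)) as T.
  replace (1 - Cconj v * u + Cconj v * u)%C with (RtoC 1) in T by ring.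
  rewrite Cmod_1, Cmod_mult, Cmod_conj in T. lra.
Qed.

(** Converse comparison to [nsq_sub_le]; the constant depends on [v] alone, so [u] may be anywhere
    in the disk. *)
Lemma phd_le_dist (u v : C) : Cmod u < 1 -> Cmod v < 1 ->
  phd u v <= (Cmod (u - v)%C / (1 - Cmod v)) ^ 2.
Proof.
  intros Hu Hv. unfold phd, nsq.
  assert (H : 1 - Cmod v <= Cmod (1 - Cconj v * u)%C).
  { pose proof (Cmod_one_sub_ge u v). pose proof (Cmod_ge_0 v). pose proof (Cmod_ge_0 u). nra. }
  unfold Rdiv. rewrite Rpow_mult_distr, pow_inv.
  apply Rmult_le_compat_l; [apply pow2_ge_0|]. apply Rinv_le_contravar.
  - apply pow_lt. lra.
  - apply pow_incr. lra.
Qed.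

(** * Convergence and nonexpansive maps of the disk *)

Definition converges (x : nat -> C) (L : C) : Prop :=
  forall eps, 0 < eps -> exists N, forall n, (N <= n)%nat -> Cmod (x n - L)%C < eps.

(** The balls of the product uniform structure on [C] are squares; they compare with [Cmod] up to
    the factor [sqrt 2]. *)
Lemma converges_filterlim (x : nat -> C) (L : C) :
  converges x L <-> filterlim x eventually (locally L).
Proof.
  split.
  - intros H. apply filterlim_locally. intros eps.
    destruct (H eps (cond_pos eps)) as [N HN]. exists N. intros n Hn.
    apply C_NormedModule_mixin_compat1. exact (HN n Hn).
  - intros H eps He.
    assert (He' : 0 < eps / sqrt 2) by (apply Rdiv_lt_0_compat; [lra|apply Rlt_sqrt2_0]).
    destruct (proj1 (filterlim_locally x L) H (mkposreal _ He')) as [N HN].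
    exists N. intros n Hn. specialize (HN n Hn).
    apply C_NormedModule_mixin_compat2 in HN. simpl in HN.
    replace (sqrt 2 * (eps / sqrt 2)) with eps in HN
      by (field; pose proof Rlt_sqrt2_0; lra).
    exact HN.
Qed.

Lemma Cmod_sub_sym (x y : C) : Cmod (x - y)%C = Cmod (y - x)%C.
Proof. rewrite <- Cmod_opp. f_equal. ring. Qed.

Lemma Cmod_sub_triangle (x y z : C) : Cmod (x - z)%C <= Cmod (x - y)%C + Cmod (y - z)%C.
Proof. replace (x - z)%C with ((x - y) + (y - z))%C by ring. apply Cmod_triangle. Qed.

Definition nonexpansive (f : C -> C) : Prop :=
  (forall z, Cmod z < 1 -> Cmod (f z) < 1) /\
  (forall u v, Cmod u < 1 -> Cmod v < 1 -> phd (f u) (f v) <= phd u v).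

Lemma nonexpansive_lipschitz (f : C -> C) (u v : C) :
  nonexpansive f -> Cmod u < 1 -> Cmod v < 1 ->
  Cmod (f u - f v)%C <= 2 * (Cmod (u - v)%C / (1 - Cmod v)).
Proof.
  intros [Hf Hn] Hu Hv.
  pose proof (nsq_sub_le _ _ (Hf u Hu) (Hf v Hv)) as H1.
  pose proof (Hn u v Hu Hv) as H2. pose proof (phd_le_dist u v Hu Hv) as H3.
  assert (0 <= Cmod (u - v)%C / (1 - Cmod v)).
  { apply Rmult_le_pos; [apply Cmod_ge_0|]. apply Rlt_le, Rinv_0_lt_compat. lra. }
  unfold nsq in H1. pose proof (Cmod_ge_0 (f u - f v)%C).
  set (a := Cmod (u - v)%C / (1 - Cmod v)) in *. nra.
Qed.

Lemma nonexpansive_limit_fixed (f : C -> C) (x : nat -> C) (L : C) :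
  nonexpansive f -> (forall n, Cmod (x n) < 1) -> (forall n, x (S n) = f (x n)) ->
  Cmod L < 1 -> converges x L -> f L = L.
Proof.
  intros Hf Hx Hrec HL Hlim.
  destruct (Ceq_dec (f L - L)%C 0) as [E|E].
  { replace (f L) with (f L - L + L)%C by ring. rewrite E. ring. }
  exfalso. apply Cmod_gt_0 in E. set (D := Cmod (f L - L)%C) in *.
  set (m := 1 - Cmod L).
  assert (Hm : 0 < m <= 1) by (unfold m; pose proof (Cmod_ge_0 L); lra).
  (* With this tolerance [f (x N)] is within [D / 4] of [L] and within [D / 2] of [f L], so [L] and
     [f L] are closer than [D]. *)
  destruct (Hlim (D * m / 4)) as [N HN]; [nra|].
  pose proof (HN N (le_n _)) as H1. pose proof (HN (S N) (le_S _ _ (le_n _))) as H2.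
  rewrite Hrec in H2.
  pose proof (nonexpansive_lipschitz f (x N) L Hf (Hx N) HL) as H3. fold m in H3.
  assert (Cmod (x N - L)%C / m < D / 4).
  { apply (Rmult_lt_reg_r m); [lra|]. unfold Rdiv at 1. rewrite Rmult_assoc, Rinv_l; lra. }
  pose proof (Cmod_sub_triangle (f L) (f (x N)) L) as T. rewrite (Cmod_sub_sym (f L) (f (x N))) in T.
  fold D in T. nra.
Qed.

(** * The parameter as a function of the fixed point *)

(* The solution [w] of [mob w (u ^ d) = u], with the common factor [1 - nsq u]
   cancelled so that it extends to the unit circle. *)
Definition phi (d : nat) (u : C) : C :=
  ((u ^ d - u * RtoC (geoR d (nsq u))) / RtoC (geoR (S d) (nsq u)))%C.

Lemma Cmult_eq_reg_r (r x y : C) : (x * r = y * r)%C -> r <> 0 -> x = y.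
Proof.
  intros H Hr. replace x with (x * r / r)%C by (field; exact Hr). rewrite H. field. exact Hr.
Qed.

Lemma RtoC_conj (a : R) : Cconj (RtoC a) = RtoC a.
Proof. unfold Cconj, RtoC; simpl. f_equal. ring. Qed.

Lemma phi_den_neq_0 (d : nat) (u : C) : RtoC (geoR (S d) (nsq u)) <> 0.
Proof.
  intros E. apply RtoC_inj in E. pose proof (geoR_ge_1 d _ (nsq_ge_0 u)). lra.
Qed.

(** Cleared of denominators, the equation is [x - w = u * (1 - Cconj w * x)] with [x = u^d]. It
    follows from two ways of splitting the sum of length [d + 1]: off its last term ([E3]) or off
    its first ([E4]). Circle points [u] are included for the boundary argument. *)
Lemma phi_fixed (d : nat) (u : C) :
  Cmod u <= 1 -> Cmod (phi d u) < 1 -> mob (phi d u) (u ^ d) = u.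
Proof.
  intros Hu Hw. set (w := phi d u) in *.
  assert (Hx : Cmod (u ^ d)%C <= 1).
  { rewrite Cmod_pow. rewrite <- (pow1 d). apply pow_incr. split; [apply Cmod_ge_0|lra]. }
  pose proof (one_sub_neq_0 _ w Hx Hw) as Hden.
  pose proof (phi_den_neq_0 d u) as HG.
  assert (E1 : (w * RtoC (geoR (S d) (nsq u)) = u ^ d - u * RtoC (geoR d (nsq u)))%C).
  { unfold w, phi. field. exact HG. }
  assert (E2 : (Cconj w * RtoC (geoR (S d) (nsq u)) =
                Cconj (u ^ d) - Cconj u * RtoC (geoR d (nsq u)))%C).
  { rewrite <- (RtoC_conj (geoR (S d) _)), <- Cmult_conj, E1.
    now rewrite Cminus_conj, Cmult_conj, RtoC_conj. }
  assert (E3 : RtoC (geoR (S d) (nsq u)) =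
     (RtoC (geoR d (nsq u)) + u ^ d * Cconj (u ^ d))%C).
  { simpl. now rewrite RtoC_plus, <- nsq_pow, nsq_conj_mult. }
  assert (E4 : RtoC (geoR (S d) (nsq u)) =
     (1 + u * Cconj u * RtoC (geoR d (nsq u)))%C).
  { now rewrite geoR_S, RtoC_plus, RtoC_mult, nsq_conj_mult. }
  set (G' := RtoC (geoR (S d) (nsq u))) in *. set (G := RtoC (geoR d (nsq u))) in *.
  set (x := (u ^ d)%C) in *.
  assert (E : (x - w = u * (1 - Cconj w * x))%C).
  { apply (Cmult_eq_reg_r G'); [|exact HG].
    replace ((x - w) * G')%C with (x * G' - w * G')%C by ring.
    replace (u * (1 - Cconj w * x) * G')%C with (u * G' - u * x * (Cconj w * G'))%C by ring.
    rewrite E1, E2. rewrite E4 at 1. rewrite E3. ring. }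
  unfold mob. rewrite E. field. exact Hden.
Qed.

(** The fixed point equation and its conjugate are linear in [w] and [Cconj w]. Eliminating
    [Cconj w] leaves an equation for [w] whose coefficients telescope, and [1 - nsq u] can be
    cancelled. *)
Lemma fixed_phi (d : nat) (w u : C) :
  Cmod w < 1 -> Cmod u < 1 -> mob w (u ^ d) = u -> w = phi d u.
Proof.
  intros Hw Hu H.
  assert (Hx : Cmod (u ^ d)%C <= 1).
  { rewrite Cmod_pow. rewrite <- (pow1 d). apply pow_incr. split; [apply Cmod_ge_0|lra]. }
  pose proof (one_sub_neq_0 _ w Hx Hw) as Hden.
  assert (E : (u ^ d - w = u * (1 - Cconj w * u ^ d))%C).
  { rewrite <- H at 2. unfold mob. field. exact Hden. }
  assert (E' : (Cconj (u ^ d) - Cconj w = Cconj u * (1 - w * Cconj (u ^ d)))%C).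
  { rewrite <- Cminus_conj, E, Cmult_conj, Cminus_conj, Cmult_conj, Cconj_conj, RtoC_conj.
    reflexivity. }
  assert (T : (RtoC (geoR d (nsq u)) * (1 - u * Cconj u) = 1 - u ^ d * Cconj (u ^ d))%C).
  { rewrite <- !nsq_conj_mult, <- !RtoC_minus, <- RtoC_mult, geoR_telescope, nsq_pow. reflexivity. }
  assert (T' : (RtoC (geoR (S d) (nsq u)) * (1 - u * Cconj u) =
                1 - u * Cconj u * (u ^ d * Cconj (u ^ d)))%C).
  { rewrite <- !nsq_conj_mult, nsq_pow, <- !RtoC_mult, <- !RtoC_minus, <- RtoC_mult, geoR_telescope.
    reflexivity. }
  assert (Hn : (1 - u * Cconj u)%C <> 0).
  { rewrite <- nsq_conj_mult, <- RtoC_minus. intros F. apply RtoC_inj in F.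
    apply nsq_lt_1 in Hu. lra. }
  unfold phi. pose proof (phi_den_neq_0 d u) as HG.
  set (G' := RtoC (geoR (S d) (nsq u))) in *. set (G := RtoC (geoR d (nsq u))) in *.
  set (x := (u ^ d)%C) in *.
  apply (Cmult_eq_reg_r G'); [|exact HG].
  replace ((x - u * G) / G' * G')%C with (x - u * G)%C by (field; exact HG).
  apply (Cmult_eq_reg_r (1 - u * Cconj u)%C); [|exact Hn].
  replace (w * G' * (1 - u * Cconj u))%C with (w * (G' * (1 - u * Cconj u)))%C by ring.
  replace ((x - u * G) * (1 - u * Cconj u))%C
    with (x * (1 - u * Cconj u) - u * (G * (1 - u * Cconj u)))%C by ring.
  rewrite T, T'.
  assert (E2 : (Cconj w = Cconj x - Cconj u * (1 - w * Cconj x))%C) by (rewrite <- E'; ring).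
  rewrite E2 in E.
  replace (w * (1 - u * Cconj u * (x * Cconj x)))%C
    with (x - (x - w) - w * (u * Cconj u * (x * Cconj x)))%C by ring.
  rewrite E. ring.
Qed.

Lemma Cmod_phi_lt_1 (d : nat) (u : C) : (2 <= d)%nat -> Cmod u < 1 -> Cmod (phi d u) < 1.
Proof.
  intros Hd Hu. unfold phi. rewrite Cmod_div by apply phi_den_neq_0.
  pose proof (geoR_ge_1 d _ (nsq_ge_0 u)) as HG'.
  pose proof (geoR_ge_0 d _ (nsq_ge_0 u)) as HG.
  rewrite Cmod_R, Rabs_pos_eq by lra.
  apply (Rmult_lt_reg_r (geoR (S d) (nsq u))); [lra|].
  unfold Rdiv. rewrite Rmult_assoc, Rinv_l, Rmult_1_r, Rmult_1_l by lra.
  pose proof (Cmod_triangle (u ^ d) (- (u * RtoC (geoR d (nsq u))))) as T.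
  rewrite Cmod_opp, Cmod_mult, Cmod_R, Rabs_pos_eq, Cmod_pow in T by lra.
  eapply Rle_lt_trans; [exact T|].
  pose proof (Cmod_ge_0 u) as H0.
  assert (Hy : 0 <= Cmod u ^ d < 1).
  { split; [now apply pow_le|]. rewrite <- Cmod_pow.
    destruct d as [|d]; [lia|]. now apply Cmod_pow_lt_1. }
  assert (E : geoR d (nsq u) * (1 - Cmod u ^ 2) = 1 - (Cmod u ^ d) ^ 2).
  { unfold nsq. rewrite geoR_telescope, <- !pow_mult, (Nat.mul_comm 2 d). reflexivity. }
  rewrite geoR_S. unfold nsq at 2.
  set (r := Cmod u) in *. set (y := r ^ d) in *. set (G := geoR d (nsq u)) in *.
  apply (Rmult_lt_reg_r (1 - r ^ 2)); [nra|].
  replace ((y + r * G) * (1 - r ^ 2)) with (y * (1 - r ^ 2) + r * (G * (1 - r ^ 2))) by ring.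
  replace ((1 + r ^ 2 * G) * (1 - r ^ 2))
    with (1 - r ^ 2 + r ^ 2 * (G * (1 - r ^ 2))) by ring.
  rewrite E.
  (* This product is exactly the difference of the two sides of the goal. *)
  assert (0 < (1 - r) * (1 - y) * (1 - r * y)).
  { apply Rmult_lt_0_compat; nra. }
  nra.
Qed.

(** * Elliptic maps and interior fixed points *)

Lemma nonexpansive_mob_pow (d : nat) (w : C) : (2 <= d)%nat -> Cmod w < 1 ->
  nonexpansive (fun u => mob w (u ^ d)%C).
Proof.
  intros Hd Hw. destruct d as [|[|n]]; [lia|lia|]. split.
  - intros z Hz. apply Cmod_mob_lt_1; [exact Hw|]. now apply Cmod_pow_lt_1.
  - intros u v Hu Hv. rewrite phd_mob by (try assumption; now apply Cmod_pow_lt_1).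
    now apply phd_pow_le.
Qed.

Lemma nonexpansive_blaschke (d : nat) (w : C) : (2 <= d)%nat -> Cmod w < 1 ->
  nonexpansive (blaschke d w).
Proof.
  intros Hd Hw. destruct d as [|[|n]]; [lia|lia|].
  change (blaschke (S (S n)) w) with (fun z => (mob w z ^ S (S n))%C). split.
  - intros z Hz. now apply Cmod_pow_lt_1, Cmod_mob_lt_1.
  - intros u v Hu Hv. rewrite <- (phd_mob w u v) by assumption.
    apply phd_pow_le; now apply Cmod_mob_lt_1.
Qed.

Lemma elliptic_fixed (d : nat) (w : C) : (2 <= d)%nat -> Cmod w < 1 ->
  elliptic (blaschke d w) -> exists u, Cmod u < 1 /\ w = phi d u.
Proof.
  intros Hd Hw [z0 [[_ Hlim] Hz0]].
  pose proof (nonexpansive_blaschke d w Hd Hw) as HB.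
  assert (H0 : Cmod 0 < 1) by (rewrite Cmod_0; lra).
  assert (F : blaschke d w z0 = z0).
  { apply (nonexpansive_limit_fixed _ (fun n => iterate (blaschke d w) n 0) z0 HB).
    - intros n. unfold iterate. apply Nat.iter_invariant; [apply HB|exact H0].
    - reflexivity.
    - exact Hz0.
    - apply converges_filterlim. now apply Hlim. }
  (* A fixed point [z0] of [P o M] yields the fixed point [M z0] of [M o P]. *)
  exists (mob w z0). split; [now apply Cmod_mob_lt_1|].
  apply fixed_phi; [exact Hw|now apply Cmod_mob_lt_1|].
  change (mob w (blaschke d w z0) = mob w z0). now rewrite F.
Qed.

Lemma converges_of_phd (x : nat -> C) (L : C) (k A : R) : 0 < k < 1 -> Cmod L < 1 ->
  (forall n, Cmod (x n) < 1) -> (forall n, phd (x n) L <= k ^ n * A) -> converges x L.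
Proof.
  intros Hk HL Hx H eps He.
  assert (HA : 0 <= A).
  { pose proof (H O). pose proof (phd_ge_0 _ _ (Hx O) HL). simpl in *. lra. }
  destruct (pow_lt_1_zero k) with (y := eps ^ 2 / (4 * (A + 1))) as [N HN].
  { rewrite Rabs_pos_eq; lra. }
  { apply Rdiv_lt_0_compat; nra. }
  exists N. intros n Hn. specialize (HN n Hn).
  rewrite Rabs_pos_eq in HN by (apply pow_le; lra).
  pose proof (nsq_sub_le _ _ (Hx n) HL) as H1. specialize (H n).
  assert (k ^ n * (4 * (A + 1)) < eps ^ 2).
  { apply (Rmult_lt_compat_r (4 * (A + 1))) in HN; [|lra].
    unfold Rdiv in HN. rewrite Rmult_assoc, Rinv_l in HN; lra. }
  assert (0 <= k ^ n) by (apply pow_le; lra).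
  unfold nsq in H1. pose proof (Cmod_ge_0 (x n - L)%C). nra.
Qed.

(** The distance to [u0] never increases, so the orbit stays in a compact disk, on which the power
    map contracts by a uniform factor. *)
Lemma mob_pow_iter_converges (d : nat) (w u0 v : C) : (2 <= d)%nat -> Cmod w < 1 ->
  Cmod u0 < 1 -> mob w (u0 ^ d) = u0 -> Cmod v < 1 ->
  converges (fun n => Nat.iter n (fun u => mob w (u ^ d)%C) v) u0.
Proof.
  intros Hd Hw Hu0 Hfix Hv.
  pose proof (nonexpansive_mob_pow d w Hd Hw) as HH.
  set (h := fun u => mob w (u ^ d)%C) in *. set (x := fun n => Nat.iter n h v).
  assert (Hx : forall n, Cmod (x n) < 1).
  { intros n. apply Nat.iter_invariant; [apply HH|exact Hv]. }
  assert (Hrec : forall n, x (S n) = h (x n)) by reflexivity.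
  assert (He : forall n, phd (x n) u0 <= phd v u0).
  { induction n as [|n IH]; [apply Rle_refl|]. rewrite Hrec. 
    replace (phd (h (x n)) u0) with (phd (h (x n)) (h u0)) by (now rewrite <- Hfix at 2).
    eapply Rle_trans; [|exact IH]. now apply HH. }
  (* Lower bound for [1 - nsq (x m)] along the orbit, obtained from [one_sub_phd] and
     [1 - Cmod u0 <= Cmod (1 - Cconj u0 * x m)]. *)
  set (s1 := (1 - phd v u0) * (1 - Cmod u0) ^ 2).
  pose proof (phd_lt_1 v u0 Hv Hu0) as P1. pose proof (phd_ge_0 v u0 Hv Hu0) as P0.
  pose proof (Cmod_ge_0 u0) as U0. pose proof (proj2 (nsq_lt_1 u0) Hu0) as U1.
  pose proof (nsq_ge_0 u0) as U2.
  assert (Hs1 : 0 < s1 <= 1).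
  { unfold s1. assert (0 < (1 - Cmod u0) ^ 2 <= 1) by nra. nra. }
  (* Below both [s1] and [1 - nsq u0], so it serves the orbit and [u0] alike; halving keeps it below
     1 even if both equal 1. *)
  assert (Hs : 0 < s1 * (1 - nsq u0) / 2 < 1) by nra.
  destruct d as [|[|n]]; [lia|lia|].
  destruct (phd_pow_contract n _ Hs) as [k [Hk Hc]].
  apply (converges_of_phd x u0 k (phd v u0)); try assumption.
  assert (Hb : forall m, s1 <= 1 - nsq (x m)).
  { intros m. pose proof (one_sub_phd _ _ (Hx m) Hu0) as E.
    pose proof (nsq_one_sub_gt_0 _ _ (Hx m) Hu0) as X0.
    assert (X1 : (1 - Cmod u0) ^ 2 <= nsq (1 - Cconj u0 * x m)%C).
    { apply pow_incr. split; [lra|]. eapply Rle_trans; [|apply Cmod_one_sub_ge].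
      pose proof (Hx m). pose proof (Cmod_ge_0 (x m)). nra. }
    specialize (He m). set (X := nsq (1 - Cconj u0 * x m)%C) in *.
    assert (E' : (1 - phd (x m) u0) * X = (1 - nsq (x m)) * (1 - nsq u0)).
    { rewrite E. field. lra. }
    assert (s1 <= (1 - phd (x m) u0) * X).
    { apply Rmult_le_compat; try lra. apply pow2_ge_0. }
    pose proof (proj2 (nsq_lt_1 (x m)) (Hx m)). nra. }
  induction n0 as [|m IH].
  { simpl. rewrite Rmult_1_l. apply Rle_refl. }
  rewrite Hrec. rewrite <- Hfix at 1. unfold h.
  rewrite phd_mob by (try assumption; now apply Cmod_pow_lt_1).
  eapply Rle_trans; [apply Hc|].
  - pose proof (Hb m). nra.
  - nra.
  - simpl. rewrite Rmult_assoc. apply Rmult_le_compat_l; lra.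
Qed.

Lemma phi_elliptic (d : nat) (u : C) : (2 <= d)%nat -> Cmod u < 1 ->
  elliptic (blaschke d (phi d u)).
Proof.
  intros Hd Hu. set (w := phi d u).
  assert (Hw : Cmod w < 1) by now apply Cmod_phi_lt_1.
  assert (Hfix : mob w (u ^ d) = u) by (apply phi_fixed; [lra|exact Hw]).
  assert (Hud : Cmod (u ^ d)%C < 1).
  { destruct d as [|d]; [lia|]. now apply Cmod_pow_lt_1. }
  exists (u ^ d)%C. split; [|exact Hud]. split; [apply Rlt_le, Hud|].
  intros z Hz. apply converges_filterlim.
  pose proof (mob_pow_iter_converges d w u (mob w z) Hd Hw Hu Hfix
    (Cmod_mob_lt_1 w z Hw Hz)) as Hc.
  set (h := fun v => mob w (v ^ d)%C) in *.
  assert (Hx : forall n, Cmod (Nat.iter n h (mob w z)) < 1).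
  { intros n. apply Nat.iter_invariant; [apply (nonexpansive_mob_pow d w Hd Hw)|].
    now apply Cmod_mob_lt_1. }
  (* The regrouping [(P o M)^(n+1) = P o (M o P)^n o M], which shifts the index by one. *)
  assert (Hit : forall n, iterate (blaschke d w) (S n) z = (Nat.iter n h (mob w z) ^ d)%C).
  { induction n as [|n IH]; [reflexivity|].
    change (iterate (blaschke d w) (S (S n)) z)
      with (mob w (iterate (blaschke d w) (S n) z) ^ d)%C.
    now rewrite IH. }
  assert (Hp : nonexpansive (fun v => v ^ d)%C).
  { destruct d as [|[|n]]; [lia|lia|]. split.
    - intros v Hv. now apply Cmod_pow_lt_1.
    - intros a b Ha Hb. now apply phd_pow_le. }
  intros eps He. set (m := 1 - Cmod u).
  assert (Hm : 0 < m) by (unfold m; lra).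
  destruct (Hc (eps * m / 2)) as [N HN]; [nra|].
  exists (S N). intros [|n] Hn; [lia|]. rewrite Hit.
  eapply Rle_lt_trans; [apply (nonexpansive_lipschitz _ _ _ Hp (Hx n) Hu)|].
  fold m. specialize (HN n ltac:(lia)).
  apply (Rmult_lt_reg_r m); [exact Hm|].
  replace (2 * (Cmod (Nat.iter n h (mob w z) - u)%C / m) * m)
    with (2 * Cmod (Nat.iter n h (mob w z) - u)%C) by (field; lra).
  lra.
Qed.

(** * Persistence of the interior fixed point under perturbation *)

Lemma real_geometric_cauchy (a : nat -> R) (A q : R) : 0 <= q < 1 ->
  (forall n, Rabs (a (S n) - a n) <= A * q ^ n) -> exists l : R, is_lim_seq a l.
Proof.
  intros Hq H.
  assert (Hs : ex_series (fun n => a (S n) - a n)).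
  { apply (@ex_series_le R_AbsRing R_CompleteNormedModule _ (fun n => A * q ^ n)); [exact H|].
    apply (@ex_series_scal_l R_AbsRing R_NormedModule A (fun n => q ^ n)), ex_series_geom. rewrite Rabs_pos_eq; lra. }
  destruct Hs as [s Hs]. exists (s + a O). apply is_lim_seq_incr_1.
  apply (is_lim_seq_ext (fun n => sum_n (fun n => a (S n) - a n) n + a O)).
  - intros n. induction n as [|n IH]; [rewrite sum_O; ring|].
    rewrite sum_Sn. unfold plus; simpl. simpl in IH. lra.
  - apply (is_lim_seq_plus _ _ s (a O)); [exact Hs|apply is_lim_seq_const|reflexivity].
Qed.

Lemma geometric_cauchy (x : nat -> C) (A q : R) : 0 <= q < 1 ->
  (forall n, Cmod (x (S n) - x n)%C <= A * q ^ n) -> exists L, converges x L.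
Proof.
  intros Hq H.
  destruct (real_geometric_cauchy (fun n => fst (x n)) A q Hq) as [l1 H1].
  { intros n. eapply Rle_trans; [|apply H].
    eapply Rle_trans; [|apply Rmax_Cmod]. apply Rmax_l. }
  destruct (real_geometric_cauchy (fun n => snd (x n)) A q Hq) as [l2 H2].
  { intros n. eapply Rle_trans; [|apply H].
    eapply Rle_trans; [|apply Rmax_Cmod]. apply Rmax_r. }
  exists (l1, l2). apply converges_filterlim. apply filterlim_locally. intros eps.
  pose proof (proj1 (filterlim_locally _ l1) H1 eps) as E1.
  pose proof (proj1 (filterlim_locally _ l2) H2 eps) as E2.
  generalize (filter_and _ _ E1 E2). apply filter_imp. intros n [h1 h2]. now split.
Qed.

Lemma mob_param_lipschitz (w w0 y : C) : Cmod w < 1 -> Cmod w0 < 1 -> Cmod y < 1 ->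
  Cmod (mob w y - mob w0 y)%C <= 4 * Cmod (w - w0)%C / (1 - Cmod y) ^ 2.
Proof.
  intros Hw Hw0 Hy.
  pose proof (one_sub_neq_0 y w (Rlt_le _ _ Hy) Hw) as N1.
  pose proof (one_sub_neq_0 y w0 (Rlt_le _ _ Hy) Hw0) as N2.
  (* The numerator is grouped into four multiples of [w - w0] or its conjugate, each of modulus at
     most [Cmod (w - w0)]; hence the constant 4. *)
  assert (E : (mob w y - mob w0 y = (- (w - w0) + y * y * Cconj (w - w0) +
     (y * Cconj w0 * (w - w0) + - (y * w0 * Cconj (w - w0)))) /
     ((1 - Cconj w * y) * (1 - Cconj w0 * y)))%C).
  { rewrite Cminus_conj. unfold mob. field. tauto. }
  rewrite E, Cmod_div by now apply Cmult_neq_0.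
  rewrite Cmod_mult.
  assert (B1 : 1 - Cmod y <= Cmod (1 - Cconj w * y)%C).
  { eapply Rle_trans; [|apply Cmod_one_sub_ge]. pose proof (Cmod_ge_0 y). nra. }
  assert (B2 : 1 - Cmod y <= Cmod (1 - Cconj w0 * y)%C).
  { eapply Rle_trans; [|apply Cmod_one_sub_ge]. pose proof (Cmod_ge_0 y). nra. }
  apply Rmult_le_compat.
  - apply Cmod_ge_0.
  - apply Rlt_le, Rinv_0_lt_compat. nra.
  - eapply Rle_trans; [apply Cmod_triangle|].
    pose proof (Cmod_triangle (- (w - w0)) (y * y * Cconj (w - w0))) as T1.
    pose proof (Cmod_triangle (y * Cconj w0 * (w - w0)) (- (y * w0 * Cconj (w - w0)))) as T2.
    rewrite Cmod_opp, !Cmod_mult, Cmod_conj in T1. rewrite Cmod_opp, !Cmod_mult, !Cmod_conj in T2.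
    pose proof (Cmod_ge_0 y). pose proof (Cmod_ge_0 w0). pose proof (Cmod_ge_0 (w - w0)%C).
    assert (Cmod y * Cmod y * Cmod (w - w0)%C <= 1 * Cmod (w - w0)%C)
      by (apply Rmult_le_compat_r; nra).
    assert (Cmod y * Cmod w0 * Cmod (w - w0)%C <= 1 * Cmod (w - w0)%C)
      by (apply Rmult_le_compat_r; nra).
    lra.
  - apply Rinv_le_contravar; [apply pow_lt; lra|]. simpl. rewrite Rmult_1_r.
    apply Rmult_le_compat; lra.
Qed.

Lemma converges_bound (x : nat -> C) (L c : C) (r : R) :
  converges x L -> (forall n, Cmod (x n - c)%C <= r) -> Cmod (L - c)%C <= r.
Proof.
  intros H Hb. apply le_epsilon. intros eps He.
  destruct (H eps He) as [N HN]. specialize (HN N (le_n _)). specialize (Hb N).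
  pose proof (Cmod_sub_triangle L (x N) c) as T. rewrite (Cmod_sub_sym L (x N)) in T. lra.
Qed.

(* The orbit of the old fixed point under the perturbed map is a geometric
   Cauchy sequence which never leaves a fixed compact disk. *)
Lemma phi_image_open (d : nat) (u0 : C) : (2 <= d)%nat -> Cmod u0 < 1 ->
  exists eps, 0 < eps /\ forall w, Cmod (w - phi d u0)%C < eps ->
    exists u, Cmod u < 1 /\ w = phi d u.
Proof.
  intros Hd Hu0. set (w0 := phi d u0).
  assert (Hw0 : Cmod w0 < 1) by now apply Cmod_phi_lt_1.
  assert (Hfix : mob w0 (u0 ^ d) = u0) by (apply phi_fixed; [lra|exact Hw0]).
  pose proof (Cmod_ge_0 u0) as U0.
  set (m := 1 - Cmod u0). assert (Hm : 0 < m) by (unfold m; lra).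
  (* The confining radius: a displacement of at most [m / 2] from [u0] stays inside it. *)
  set (R := (1 + Cmod u0) / 2).
  assert (HR : 1 / 2 <= R < 1) by (unfold R; lra).
  assert (Hs : 0 < 1 - R ^ 2 < 1) by nra.
  assert (Hy : Cmod (u0 ^ d)%C < 1).
  { destruct d as [|d]; [lia|]. now apply Cmod_pow_lt_1. }
  set (y := (u0 ^ d)%C) in *.
  destruct d as [|[|n]]; [lia|lia|]. set (d := S (S n)) in *.
  destruct (phd_pow_contract n _ Hs) as [k [Hk Hc]]. fold d in Hc.
  (* [phd] is a squared distance, so step lengths shrink by the square root of its contraction
     factor. *)
  set (q := sqrt k).
  assert (Hq : 0 < q < 1).
  { split; [apply sqrt_lt_R0; lra|]. rewrite <- sqrt_1. apply sqrt_lt_1; lra. }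
  assert (Hqk : q ^ 2 = k) by (unfold q; rewrite pow2_sqrt; lra).
  (* Chosen so that the first displacement [eta] is at most [m^2 (1 - q) / 4], which bounds the sum
     [A / (1 - q)] of all steps by [m / 2]. *)
  set (e2 := m ^ 2 * (1 - q) * (1 - Cmod y) ^ 2 / 16).
  assert (He2 : 0 < e2).
  { unfold e2. apply Rdiv_lt_0_compat; [|lra].
    repeat apply Rmult_lt_0_compat; nra. }
  exists (Rmin (1 - Cmod w0) e2). split; [apply Rmin_pos; lra|].
  intros w Hww.
  assert (Hw : Cmod w < 1).
  { pose proof (Cmod_triangle (w - w0) w0) as T.
    replace (w - w0 + w0)%C with w in T by ring.
    pose proof (Rmin_l (1 - Cmod w0) e2). lra. }
  assert (Hwe : Cmod (w - w0)%C < e2) by (pose proof (Rmin_r (1 - Cmod w0) e2); lra).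
  set (eta := Cmod (mob w y - u0)%C).
  assert (Heta : eta <= m ^ 2 * (1 - q) / 4).
  { unfold eta. rewrite <- Hfix. eapply Rle_trans; [apply mob_param_lipschitz; assumption|].
    apply (Rmult_le_reg_r ((1 - Cmod y) ^ 2)); [apply pow_lt; lra|].
    unfold Rdiv at 1. rewrite Rmult_assoc, Rinv_l by (apply pow_nonzero; lra).
    unfold e2 in Hwe. lra. }
  assert (Heta0 : 0 <= eta) by apply Cmod_ge_0.
  pose proof (nonexpansive_mob_pow d w Hd Hw) as HH.
  set (h := fun u => mob w (u ^ d)%C) in *. set (x := fun n => Nat.iter n h u0).
  assert (Hrec : forall n, x (S n) = h (x n)) by reflexivity.
  assert (Hx : forall n, Cmod (x n) < 1).
  { intros i. apply Nat.iter_invariant; [apply HH|exact Hu0]. }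
  set (A := 2 * (eta / m)).
  assert (Hem : 0 <= eta / m).
  { apply Rmult_le_pos; [lra|]. apply Rlt_le, Rinv_0_lt_compat. lra. }
  assert (HA : A / (1 - q) <= m / 2).
  { apply (Rmult_le_reg_r ((1 - q) * m)); [nra|]. unfold A.
    replace (2 * (eta / m) / (1 - q) * ((1 - q) * m)) with (2 * eta) by (field; lra).
    nra. }
  assert (Hstep : forall i, phd (x (S i)) (x i) <= k ^ i * (eta / m) ^ 2 ->
      Cmod (x (S i) - x i)%C <= A * q ^ i).
  { intros i Hi. pose proof (nsq_sub_le _ _ (Hx (S i)) (Hx i)) as Hn.
    assert (0 <= q ^ i) by (apply pow_le; lra).
    apply Rsqr_incr_0_var; [|unfold A; nra].
    unfold nsq in Hn. rewrite <- Hqk, <- pow_mult, Nat.mul_comm, pow_mult in Hi.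
    unfold Rsqr, A. nra. }
  (* The two bounds are proved together: the contraction applies only inside radius [R], and staying
     there relies on the previous steps being small. *)
  assert (Hall : forall i, Cmod (x i - u0)%C <= A * (1 - q ^ i) / (1 - q) /\
      phd (x (S i)) (x i) <= k ^ i * (eta / m) ^ 2).
  { assert (Hin : forall i, Cmod (x i - u0)%C <= A * (1 - q ^ i) / (1 - q) ->
        1 - R ^ 2 <= 1 - nsq (x i)).
    { intros i Hi. assert (0 <= q ^ i) by (apply pow_le; lra).
      assert (A * (1 - q ^ i) / (1 - q) <= A / (1 - q)).
      { apply Rmult_le_compat_r; [apply Rlt_le, Rinv_0_lt_compat; lra|]. unfold A. nra. }
      pose proof (Cmod_triangle (x i - u0) u0) as T.
      replace (x i - u0 + u0)%C with (x i) in T by ring.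
      assert (Cmod (x i) <= R) by (unfold R; unfold m in HA; lra).
      pose proof (Cmod_ge_0 (x i)). unfold nsq. nra. }
    induction i as [|i [IH1 IH2]].
    - simpl. replace (u0 - u0)%C with (RtoC 0) by ring. rewrite Cmod_0. split.
      + apply Req_le. field. lra.
      + rewrite Rmult_1_l. apply phd_le_dist; [apply (Hx 1%nat)|exact Hu0].
    - assert (IH1' : Cmod (x (S i) - u0)%C <= A * (1 - q ^ S i) / (1 - q)).
      { pose proof (Cmod_sub_triangle (x (S i)) (x i) u0) as T.
        pose proof (Hstep i IH2).
        replace (A * (1 - q ^ S i) / (1 - q))
          with (A * q ^ i + A * (1 - q ^ i) / (1 - q)) by (simpl; field; lra).
        lra. }
      split; [exact IH1'|].
      change (phd (x (S (S i))) (x (S i)))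
        with (phd (mob w (x (S i) ^ d)%C) (mob w (x i ^ d)%C)).
      rewrite phd_mob; [|exact Hw|now apply Cmod_pow_lt_1|now apply Cmod_pow_lt_1].
      eapply Rle_trans; [apply Hc; now apply Hin|].
      simpl (k ^ S i). rewrite Rmult_assoc. apply Rmult_le_compat_l; lra. }
  destruct (geometric_cauchy x A q) as [L HL]; [lra| |].
  { intros i. apply Hstep, Hall. }
  assert (HLm : Cmod (L - u0)%C <= m / 2).
  { apply (converges_bound x); [exact HL|]. intros i. destruct (Hall i) as [Hi _].
    eapply Rle_trans; [exact Hi|]. eapply Rle_trans; [|exact HA].
    assert (0 <= q ^ i) by (apply pow_le; lra).
    apply Rmult_le_compat_r; [apply Rlt_le, Rinv_0_lt_compat; lra|]. unfold A. nra. }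
  assert (HL1 : Cmod L < 1).
  { pose proof (Cmod_triangle (L - u0) u0) as T.
    replace (L - u0 + u0)%C with L in T by ring. unfold m in *. lra. }
  exists L. split; [exact HL1|]. apply fixed_phi; try assumption.
  now apply (nonexpansive_limit_fixed h x L).
Qed.

(** * Values of [phi] on the unit circle *)

Lemma phi_unit (d : nat) (v : C) : Cmod v = 1 ->
  phi d v = ((v ^ d - v * RtoC (INR d)) / RtoC (INR d + 1))%C.
Proof.
  intros Hv. unfold phi, nsq. rewrite Hv, pow1, !geoR_1, S_INR. reflexivity.
Qed.

(* Says that the boundary fixed point [y] of [mob w ^ d] has multiplier 1. *)
Lemma epicycloid_multiplier (D : R) (y v : C) : 0 < D -> nsq y = 1 -> nsq v = 1 ->
  let w := ((y - v * RtoC D) / RtoC (D + 1))%C in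
  nsq (1 - Cconj w * y)%C = D * (1 - nsq w).
Proof.
  intros HD Hy Hv w.
  assert (HD1 : RtoC (D + 1) <> 0) by (intros E; apply RtoC_inj in E; lra).
  rewrite nsq_one_sub, Hy.
  (* Both sides of the goal equal [D^2 |y + v|^2 / (D + 1)^2]. *)
  assert (E : (y - w = RtoC D * (y + v) / RtoC (D + 1))%C).
  { unfold w. rewrite RtoC_plus in *. field. exact HD1. }
  rewrite E. unfold w. rewrite !nsq_div by exact HD1.
  assert (ED : nsq (RtoC (D + 1)) = (D + 1) ^ 2).
  { rewrite nsq_coord. unfold RtoC. simpl. ring. }
  rewrite ED. apply (Rmult_eq_reg_r ((D + 1) ^ 2)); [|apply pow_nonzero; lra].
  destruct y as [a b], v as [p q]. rewrite !nsq_coord in *. unfold RtoC in *. simpl in *.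
  field_simplify; [|lra|lra].
  assert (Ha : a ^ 2 = 1 - b ^ 2) by (rewrite <- Hy; ring).
  assert (Hp : p ^ 2 = 1 - q ^ 2) by (rewrite <- Hv; ring).
  ring_simplify [Ha Hp]. ring [Ha Hp].
Qed.

(* An interior fixed point together with a boundary fixed point of multiplier 1
   would be an equality case of Cauchy-Schwarz. *)
Lemma phi_interior_neq_boundary (d : nat) (u v : C) : (2 <= d)%nat ->
  Cmod u < 1 -> Cmod v = 1 -> phi d u <> phi d v.
Proof.
  intros Hd Hu Hv E.
  pose proof (Cmod_phi_lt_1 d u Hd Hu) as Hw.
  pose proof (phi_fixed d u (Rlt_le _ _ Hu) Hw) as Fu.
  (* The assumed equality puts [phi d v] in the open disk, so [phi_fixed] applies at the circle
     point [v] too. *)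
  rewrite E in Hw, Fu.
  pose proof (phi_fixed d v (Req_le _ _ Hv) Hw) as Fv.
  assert (Nv : nsq v = 1) by (unfold nsq; rewrite Hv; ring).
  assert (Ny : nsq (v ^ d)%C = 1) by (now rewrite nsq_pow, Nv, pow1).
  assert (HD : 0 < INR d) by (apply lt_0_INR; lia).
  pose proof (epicycloid_multiplier (INR d) (v ^ d) v HD Ny Nv) as M. simpl in M.
  rewrite <- phi_unit in M by exact Hv.
  set (w := phi d v) in *.
  assert (Hx : Cmod (u ^ d)%C < 1).
  { destruct d as [|d]; [lia|]. now apply Cmod_pow_lt_1. }
  assert (Hy : Cmod (v ^ d)%C <= 1) by (rewrite Cmod_pow, Hv, pow1; lra).
  pose proof (one_sub_nsq_mob w (u ^ d) Hw (Rlt_le _ _ Hx)) as I1.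
  pose proof (nsq_mob_one_sub w (u ^ d) (v ^ d) Hw (Rlt_le _ _ Hx) Hy) as I2.
  rewrite Fu in I1, I2. rewrite Fv, M in I2.
  pose proof (nsq_one_sub_gt_0 _ _ Hx Hw) as P1.
  assert (F : nsq (1 - Cconj (v ^ d) * u ^ d)%C =
              nsq (geoC d (Cconj v * u)) * nsq (1 - Cconj v * u)%C).
  { rewrite <- nsq_mult, geoC_telescope, Cpow_conj, Cpow_mult_l. reflexivity. }
  rewrite F in I2. rewrite nsq_pow, <- geoR_telescope in I1.
  destruct d as [|[|n]]; [lia|lia|]. set (d := S (S n)) in *.
  pose proof (geo_cauchy_schwarz n u v) as CS. fold d in CS.
  rewrite Nv, geoR_1 in CS.
  assert (Nuv : 0 < nsq (u - v)%C).
  { apply nsq_gt_0. intros G. assert (u = v).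
    { replace u with (u - v + v)%C by ring. rewrite G. ring. }
    subst u. lra. }
  assert (Nuv' : 0 < nsq (1 - Cconj v * u)%C).
  { rewrite nsq_one_sub, Nv. lra. }
  apply nsq_lt_1 in Hw, Hu.
  set (X := nsq (1 - Cconj w * u ^ d)%C) in *. set (Z := nsq (geoC d (Cconj v * u))) in *.
  set (G := geoR d (nsq u)) in *.
  assert (E1 : X = (1 - nsq w) * G).
  { apply (Rmult_eq_reg_r (1 - nsq u)); [|lra]. rewrite I1 at 1. field. lra. }
  assert (E2 : X * INR d = Z * (1 - nsq w)).
  { set (Y := nsq (1 - Cconj v * u)%C) in *.
    apply (Rmult_eq_reg_r Y); [|lra]. rewrite I2 at 1. field. repeat split; lra. }
  (* Cauchy-Schwarz gives [Z + nsq (u - v) <= G * INR d], so this equality contradicts [u <> v]. *)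
  assert (E3 : G * INR d = Z).
  { apply (Rmult_eq_reg_r (1 - nsq w)); [|lra]. rewrite <- E2, E1. ring. }
  lra.
Qed.

(** * Rotational symmetry and the sector *)

Lemma cis_add (a b : R) : cis (a + b) = (cis a * cis b)%C.
Proof.
  unfold cis, Cmult; simpl. rewrite cos_plus, sin_plus. f_equal. ring.
Qed.

Lemma cis_pow (n : nat) (t : R) : (cis t ^ n)%C = cis (INR n * t).
Proof.
  induction n as [|n IH].
  - simpl. rewrite Rmult_0_l. unfold cis. now rewrite cos_0, sin_0.
  - rewrite Cpow_S, IH, <- cis_add, S_INR. f_equal. ring.
Qed.

Lemma nsq_cis (t : R) : nsq (cis t) = 1.
Proof.
  rewrite nsq_coord. unfold cis; simpl. pose proof (sin2_cos2 t) as H. unfold Rsqr in H. lra.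
Qed.

Lemma Cmod_cis (t : R) : Cmod (cis t) = 1.
Proof.
  pose proof (nsq_cis t) as H. unfold nsq in H. pose proof (Cmod_ge_0 (cis t)). nra.
Qed.

Lemma polar_form (w : C) :
  exists t, 0 <= t < 2 * PI /\ w = (RtoC (Cmod w) * cis t)%C.
Proof.
  pose proof PI_RGT_0 as Hpi.
  destruct (Req_dec (Cmod w) 0) as [E|E].
  { exists 0. split; [lra|]. rewrite E, Cmult_0_l. now apply Cmod_eq_0. }
  pose proof (Cmod_ge_0 w). assert (Hr : 0 < Cmod w) by lra.
  pose proof (nsq_coord w) as N. unfold nsq in N. destruct w as [a b]. simpl fst in N. simpl snd in N.
  set (r := Cmod (a, b)) in *.
  assert (Hc : -1 <= a / r <= 1).
  { split; apply (Rmult_le_reg_r r); try exact Hr; unfold Rdiv; rewrite Rmult_assoc, Rinv_l; nra. }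
  pose proof (acos_bound (a / r)) as [B1 B2].
  assert (Hsq : sqrt (1 - Rsqr (a / r)) = Rabs b / r).
  { apply sqrt_lem_1.
    - unfold Rsqr. nra.
    - apply Rmult_le_pos; [apply Rabs_pos|]. apply Rlt_le, Rinv_0_lt_compat, Hr.
    - replace (Rabs b / r * (Rabs b / r)) with ((Rabs b * Rabs b) / (r * r)) by (field; lra).
      rewrite <- Rabs_mult, Rabs_pos_eq by nra. unfold Rsqr.
      replace (b * b) with (r * r - a * a) by nra. field. lra. }
  destruct (Rle_dec 0 b) as [Hb|Hb].
  - exists (acos (a / r)). split; [lra|].
    unfold cis. rewrite cos_acos, sin_acos, Hsq, Rabs_pos_eq by lra.
    unfold Cmult, RtoC; simpl. f_equal; field; lra.
  - assert (Hne : acos (a / r) <> 0).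
    { intros Z. pose proof (sin_acos _ Hc) as S. rewrite Z, sin_0, Hsq in S.
      rewrite Rabs_left in S by lra.
      assert (0 < - b / r) by (apply Rdiv_lt_0_compat; lra). lra. }
    exists (2 * PI - acos (a / r)). split; [lra|].
    unfold cis. rewrite cos_minus, sin_minus, cos_2PI, sin_2PI, cos_acos, sin_acos, Hsq by lra.
    rewrite Rabs_left by lra.
    unfold Cmult, RtoC; simpl. f_equal; field; lra.
Qed.

(** The hypotheses make [z] a root of unity of order dividing [d - 1], so the image of the disk
    under [phi] is invariant under the rotations [rot]. *)
Lemma phi_rot (d : nat) (z u : C) : nsq z = 1 -> (z ^ d)%C = z ->
  phi d (z * u) = (z * phi d u)%C.
Proof.
  intros Hz Hd. pose proof (phi_den_neq_0 d u). unfold phi.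
  rewrite nsq_mult, Hz, Rmult_1_l, Cpow_mult_l, Hd. field. assumption.
Qed.

Lemma cis_2PI (j : nat) : cis (2 * PI * INR j) = 1.
Proof.
  unfold cis. replace (2 * PI * INR j) with (0 + 2 * INR j * PI) by ring.
  rewrite cos_period, sin_period, cos_0, sin_0. reflexivity.
Qed.

Lemma root_of_unity_pow (d j : nat) : (2 <= d)%nat ->
  (cis (2 * PI * INR j / INR (d - 1)) ^ d)%C = cis (2 * PI * INR j / INR (d - 1)).
Proof.
  intros Hd. destruct d as [|d]; [lia|]. replace (S d - 1)%nat with d by lia.
  rewrite Cpow_S, cis_pow.
  replace (INR d * (2 * PI * INR j / INR d)) with (2 * PI * INR j).
  - rewrite cis_2PI. ring.
  - field. apply not_0_INR. lia.
Qed.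

Lemma Etilde_phi (d : nat) (w : C) : (2 <= d)%nat ->
  (Etilde d w <-> exists u, Cmod u < 1 /\ w = phi d u).
Proof.
  intros Hd. split.
  - intros [j [_ [v [[[Hv _] He] ->]]]].
    destruct (elliptic_fixed d v Hd Hv He) as [u [Hu ->]].
    exists (cis (2 * PI * INR j / INR (d - 1)) * u)%C. split.
    + rewrite Cmod_mult, Cmod_cis. lra.
    + unfold rot. rewrite phi_rot; [reflexivity|apply nsq_cis|now apply root_of_unity_pow].
  - intros [u [Hu Hw]].
    pose proof (Cmod_phi_lt_1 d u Hd Hu) as Hw1. rewrite <- Hw in Hw1.
    destruct (polar_form w) as [t [Ht Hp]].
    pose proof PI_RGT_0 as Hpi.
    assert (HD : 1 <= INR (d - 1)) by (change 1 with (INR 1); apply le_INR; lia).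
    set (D := INR (d - 1)) in *.
    assert (Ht0 : 0 <= t * D / (2 * PI)).
    { apply Rmult_le_pos; [nra|]. apply Rlt_le, Rinv_0_lt_compat. lra. }
    (* [j] counts the full sectors of angle [2 PI / (d - 1)] below the argument [t] of [w]; rotating
       back by [j] sectors lands in [S_d], and [t < 2 PI] gives [j <= d - 2]. *)
    destruct (nfloor_ex _ Ht0) as [j [Hj1 Hj2]].
    assert (EX : t * D / (2 * PI) * (2 * PI) = t * D) by (field; lra).
    assert (Hj1' : INR j * (2 * PI) <= t * D) by (rewrite <- EX; apply Rmult_le_compat_r; lra).
    assert (Hj2' : t * D < (INR j + 1) * (2 * PI)) by (rewrite <- EX; apply Rmult_lt_compat_r; lra).
    set (a := 2 * PI * INR j / D).
    assert (Ea : a * D = 2 * PI * INR j) by (unfold a; field; lra).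
    assert (Hroot : (cis a ^ d)%C = cis a) by now apply root_of_unity_pow.
    assert (Hinv : (cis a * cis (- a))%C = 1).
    { rewrite <- cis_add. replace (a + - a) with 0 by ring.
      unfold cis. now rewrite cos_0, sin_0. }
    assert (Hv : (cis (- a) * w)%C = phi d (cis (- a) * u)).
    { rewrite Hw, phi_rot; [reflexivity|apply nsq_cis|].
      apply (Cmult_eq_reg_r (cis a)).
      - transitivity (RtoC 1); [|rewrite <- Hinv; ring].
        rewrite <- Hroot, <- Cpow_mult_l, (Cmult_comm (cis (- a))), Hinv, Cpow_1_l. reflexivity.
      - apply Cmod_gt_0. rewrite Cmod_cis. lra. }
    exists j. split.
    + assert (INR j < D) by nra. apply INR_lt in H. lia.
    + exists (cis (- a) * w)%C. repeat split.
      * unfold in_disk. rewrite Cmod_mult, Cmod_cis. lra.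
      * exists (Cmod w), (t - a). split; [apply Cmod_ge_0|]. split.
        { split.
          - apply (Rmult_le_reg_r D); [lra|]. rewrite Rmult_minus_distr_r, Ea. lra.
          - apply (Rmult_lt_reg_r D); [lra|].
            fold D. replace (2 * PI / D * D) with (2 * PI) by (field; lra).
            rewrite Rmult_minus_distr_r, Ea. lra. }
        rewrite Hp at 1. unfold Rminus. rewrite cis_add. ring.
      * rewrite Hv. apply phi_elliptic; [exact Hd|].
        rewrite Cmod_mult, Cmod_cis. lra.
      * unfold rot. fold D a. rewrite Cmult_assoc, Hinv. ring.
Qed.

(** * Continuity in polar coordinates and compactness *)

Lemma nsq_RtoC_cis (r t : R) : nsq (RtoC r * cis t)%C = r ^ 2.
Proof. rewrite nsq_mult, nsq_cis, nsq_coord. unfold RtoC; simpl. ring. Qed.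

Lemma Cmod_RtoC_cis (r t : R) : 0 <= r -> Cmod (RtoC r * cis t)%C = r.
Proof. intros Hr. rewrite Cmod_mult, Cmod_cis, Cmod_R, Rabs_pos_eq; lra. Qed.

Lemma phi_polar (d : nat) (r t : R) :
  phi d (RtoC r * cis t) =
  ((r ^ d * cos (INR d * t) - r * cos t * geoR d (r ^ 2)) * / geoR (S d) (r ^ 2),
   (r ^ d * sin (INR d * t) - r * sin t * geoR d (r ^ 2)) * / geoR (S d) (r ^ 2)).
Proof.
  unfold phi. rewrite nsq_RtoC_cis, Cpow_mult_l, cis_pow, <- RtoC_pow.
  unfold Cdiv. rewrite <- RtoC_inv by (pose proof (geoR_ge_1 d (r ^ 2) (pow2_ge_0 r)); lra).
  unfold cis, Cmult, Cminus, Cplus, Copp, RtoC.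
  simpl. f_equal; ring.
Qed.

Lemma continuity_pt_geoR (n : nat) (x : R) : continuity_pt (geoR n) x.
Proof.
  induction n as [|n IH].
  - apply continuity_pt_const. intros a b. reflexivity.
  - apply (continuity_pt_plus (geoR n) (fun x => x ^ n)); [exact IH|].
    apply derivable_continuous_pt, derivable_pt_pow.
Qed.

Lemma continuity_2d_pt_nsq_phi (d : nat) (p : C) (r t : R) :
  continuity_2d_pt (fun r t => nsq (phi d (RtoC r * cis t) - p)%C) r t.
Proof.
  apply (continuity_2d_pt_ext (fun r t =>
    ((r ^ d * cos (INR d * t) - r * cos t * geoR d (r ^ 2)) * / geoR (S d) (r ^ 2) - fst p) *
    ((r ^ d * cos (INR d * t) - r * cos t * geoR d (r ^ 2)) * / geoR (S d) (r ^ 2) - fst p) +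
    ((r ^ d * sin (INR d * t) - r * sin t * geoR d (r ^ 2)) * / geoR (S d) (r ^ 2) - snd p) *
    ((r ^ d * sin (INR d * t) - r * sin t * geoR d (r ^ 2)) * / geoR (S d) (r ^ 2) - snd p))).
  { intros x y. rewrite phi_polar, nsq_coord. simpl. ring. }
  assert (Hpow : forall n, continuity_2d_pt (fun r _ => r ^ n) r t).
  { intros n. apply (continuity_1d_2d_pt_comp (fun x => x ^ n) (fun x _ => x)).
    - apply derivable_continuous_pt, derivable_pt_pow.
    - apply continuity_2d_pt_id1. }
  assert (Hgeo : forall n, continuity_2d_pt (fun r _ => geoR n (r ^ 2)) r t).
  { intros n. apply (continuity_1d_2d_pt_comp (geoR n) (fun x _ => x ^ 2)).
    - apply continuity_pt_geoR.
    - apply Hpow. }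
  assert (Hinv : continuity_2d_pt (fun r _ => / geoR (S d) (r ^ 2)) r t).
  { apply (continuity_2d_pt_inv (fun r _ => geoR (S d) (r ^ 2))); [apply Hgeo|].
    pose proof (geoR_ge_1 d (r ^ 2) (pow2_ge_0 r)). lra. }
  assert (Hlin : forall c, continuity_2d_pt (fun _ t => c * t) r t).
  { intros c. apply (continuity_2d_pt_mult (fun _ _ => c) (fun _ y => y)).
    - apply continuity_2d_pt_const.
    - apply continuity_2d_pt_id2. }
  assert (Hcoord : forall (f : R -> R) c, continuity f -> continuity_2d_pt (fun r t =>
      (r ^ d * f (INR d * t) - r * f t * geoR d (r ^ 2)) * / geoR (S d) (r ^ 2) - c) r t).
  { intros f c Hf.
    apply (continuity_2d_pt_minus (fun r t =>
      (r ^ d * f (INR d * t) - r * f t * geoR d (r ^ 2)) * / geoR (S d) (r ^ 2)) (fun _ _ => c));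
      [|apply continuity_2d_pt_const].
    apply (continuity_2d_pt_mult (fun r t => r ^ d * f (INR d * t) - r * f t * geoR d (r ^ 2))
      (fun r _ => / geoR (S d) (r ^ 2))); [|exact Hinv].
    apply (continuity_2d_pt_minus (fun r t => r ^ d * f (INR d * t))
      (fun r t => r * f t * geoR d (r ^ 2))).
    - apply (continuity_2d_pt_mult (fun r _ => r ^ d) (fun _ t => f (INR d * t))); [apply Hpow|].
      apply (continuity_1d_2d_pt_comp f (fun _ t => INR d * t)); [apply Hf|apply Hlin].
    - apply (continuity_2d_pt_mult (fun r t => r * f t) (fun r _ => geoR d (r ^ 2)));
        [|apply Hgeo].
      apply (continuity_2d_pt_mult (fun r _ => r) (fun _ t => f t)).
      + apply continuity_2d_pt_id1.
      + apply (continuity_1d_2d_pt_comp f (fun _ t => t)); [apply Hf|].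
        apply continuity_2d_pt_id2. }
  apply (continuity_2d_pt_plus
    (fun r t => _ * _) (fun r t => _ * _)); apply continuity_2d_pt_mult;
    apply Hcoord; (apply continuity_cos || apply continuity_sin).
Qed.

(** Each point gets one number serving both as a radius and as a lower bound for [f] within that
    radius. Compactness gives a positive lower bound for these numbers at suitable nearby points,
    hence for [f]. *)
Lemma positive_on_rectangle (f : R -> R -> R) (a b a' b' : R) :
  (forall x y, a <= x <= b -> a' <= y <= b' -> continuity_2d_pt f x y /\ 0 < f x y) ->
  exists m, 0 < m /\ forall x y, a <= x <= b -> a' <= y <= b' -> m <= f x y.
Proof.
  intros H.
  assert (Hd : forall x y, exists del : posreal, a <= x <= b -> a' <= y <= b' ->
    forall u v, Rabs (u - x) < del -> Rabs (v - y) < del -> del <= f u v).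
  { intros x y.
    destruct (excluded_middle_informative (a <= x <= b /\ a' <= y <= b')) as [[hx hy]|hn].
    - destruct (H x y hx hy) as [Hc Hp].
      assert (Hp2 : 0 < f x y / 2) by lra.
      destruct (Hc (mkposreal _ Hp2)) as [d0 Hd0]. simpl in Hd0.
      assert (Hm : 0 < Rmin d0 (f x y / 2)) by (apply Rmin_pos; [apply cond_pos|lra]).
      exists (mkposreal _ Hm). simpl. intros _ _ u v hu hv.
      pose proof (Rmin_l d0 (f x y / 2)). pose proof (Rmin_r d0 (f x y / 2)).
      specialize (Hd0 u v ltac:(lra) ltac:(lra)). apply Rabs_def2 in Hd0. lra.
    - exists (mkposreal 1 Rlt_0_1). tauto. }
  set (delta := fun x y => proj1_sig (constructive_indefinite_description _ (Hd x y))).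
  destruct (compactness_value_2d a b a' b' delta) as [m Hm].
  exists m. split; [apply cond_pos|]. intros x y hx hy.
  apply Rnot_lt_le. intros hlt. apply (Hm x y hx hy).
  intros [u [v [hu [hv [h1 [h2 h3]]]]]]. unfold delta in *.
  destruct (constructive_indefinite_description _ (Hd u v)) as [del Hdel]. simpl in *.
  specialize (Hdel hu hv x y h1 h2). lra.
Qed.

(** The image of the closed disk is closed: if [p] were missed, its squared distance to [phi] would
    have a positive lower bound [m] on the polar rectangle, contradicting an approximation within
    [sqrt m]. *)
Lemma phi_closure (d : nat) (p : C) :
  (forall eps, 0 < eps -> exists u, Cmod u < 1 /\ Cmod (phi d u - p)%C < eps) ->
  exists r t, 0 <= r <= 1 /\ 0 <= t <= 2 * PI /\ p = phi d (RtoC r * cis t).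
Proof.
  intros H.
  destruct (excluded_middle_informative
    (exists r t, 0 <= r <= 1 /\ 0 <= t <= 2 * PI /\ p = phi d (RtoC r * cis t))) as [h|hn];
    [exact h|exfalso].
  destruct (positive_on_rectangle (fun r t => nsq (phi d (RtoC r * cis t) - p)%C)
    0 1 0 (2 * PI)) as [m [Hm Hmin]].
  { intros r t hr ht. split; [apply continuity_2d_pt_nsq_phi|].
    apply nsq_gt_0. intros E. apply hn. exists r, t. repeat split; try tauto.
    replace p with (phi d (RtoC r * cis t) - (phi d (RtoC r * cis t) - p))%C at 1 by ring.
    rewrite E. ring. }
  destruct (H (sqrt m)) as [u [Hu Hp]]; [now apply sqrt_lt_R0|].
  destruct (polar_form u) as [t [Ht Hut]].
  pose proof (Cmod_ge_0 u).
  specialize (Hmin (Cmod u) t ltac:(lra) ltac:(lra)). rewrite <- Hut in Hmin.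
  unfold nsq in Hmin. pose proof (Cmod_ge_0 (phi d u - p)%C).
  pose proof (sqrt_sqrt m (Rlt_le _ _ Hm)). nra.
Qed.

Lemma phi_radial_limit (d : nat) (t eps : R) : 0 < eps ->
  exists u, Cmod u < 1 /\ Cmod (phi d u - phi d (cis t))%C < eps.
Proof.
  intros He. assert (He2 : 0 < eps ^ 2) by nra.
  destruct (continuity_2d_pt_nsq_phi d (phi d (cis t)) 1 t (mkposreal _ He2)) as [del Hdel].
  pose proof (cond_pos del) as Hdp.
  set (r := 1 - Rmin (del / 2) (1 / 2)).
  assert (Hr : 1 / 2 <= r < 1 /\ Rabs (r - 1) < del).
  { pose proof (Rmin_l (del / 2) (1 / 2)). pose proof (Rmin_r (del / 2) (1 / 2)).
    assert (0 < Rmin (del / 2) (1 / 2)) by (apply Rmin_pos; lra).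
    unfold r. split; [lra|]. apply Rabs_def1; lra. }
  specialize (Hdel r t (proj2 Hr)).
  rewrite Rminus_diag, Rabs_R0 in Hdel. specialize (Hdel Hdp). simpl in Hdel.
  rewrite Cmult_1_l in Hdel.
  replace (phi d (cis t) - phi d (cis t))%C with (RtoC 0) in Hdel by ring.
  exists (RtoC r * cis t)%C. rewrite Cmod_RtoC_cis by lra. split; [lra|].
  unfold nsq in Hdel. rewrite Cmod_0 in Hdel. apply Rabs_def2 in Hdel.
  pose proof (Cmod_ge_0 (phi d (RtoC r * cis t) - phi d (cis t))%C). nra.
Qed.

(** * Identification of the boundary *)

Lemma epicycloid_phi (d : nat) (p : C) :
  epicycloid d p <-> exists t, 0 <= t <= 2 * PI /\ p = phi d (cis t).
Proof.
  unfold epicycloid.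
  split; intros [t [Ht E]]; exists t; split; try exact Ht; rewrite E;
    rewrite phi_unit, cis_pow by apply Cmod_cis; now rewrite (Cmult_comm (cis t)).
Qed.

Lemma Cmod_phi_unit_le_1 (d : nat) (v : C) : Cmod v = 1 -> Cmod (phi d v) <= 1.
Proof.
  intros Hv. pose proof (pos_INR d).
  rewrite phi_unit by exact Hv.
  rewrite Cmod_div by (intros E; apply RtoC_inj in E; lra).
  rewrite Cmod_R, Rabs_pos_eq by lra.
  pose proof (Cmod_triangle (v ^ d) (- (v * RtoC (INR d)))) as T.
  rewrite Cmod_opp, Cmod_mult, Cmod_R, Rabs_pos_eq, Cmod_pow, Hv, pow1 in T by lra.
  apply (Rmult_le_reg_r (INR d + 1)); [lra|].
  unfold Rdiv. rewrite Rmult_assoc, Rinv_l by lra.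
  change (v ^ d + - (v * RtoC (INR d)))%C with (v ^ d - v * RtoC (INR d))%C in T. lra.
Qed.

Theorem theorem2p1 (d : nat) (hd : (2 <= d)%nat) :
  forall p : C, rel_boundary_cdisk (Etilde d) p <-> epicycloid d p.
Proof.
  intros p. rewrite epicycloid_phi. split.
  - intros [_ Hp].
    destruct (phi_closure d p) as [r [t [Hr [Ht Ep]]]].
    { intros eps He. destruct (Hp eps He) as [[q [Hq [_ Hqp]]] _].
      apply Etilde_phi in Hq; [|exact hd]. destruct Hq as [u [Hu ->]]. now exists u. }
    destruct (Rle_lt_or_eq_dec r 1 (proj2 Hr)) as [Hlt|E1].
    + exfalso.
      (* If [r < 1], a whole neighbourhood of [p] lies in [Etilde], so [p] is not a boundary
         point. *)
      destruct (phi_image_open d (RtoC r * cis t) hd) as [eps [He Hopen]].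
      { rewrite Cmod_RtoC_cis; lra. }
      rewrite <- Ep in Hopen.
      destruct (Hp eps He) as [_ [q [_ [Hq Hqp]]]].
      apply Hq, Etilde_phi; [exact hd|]. now apply Hopen.
    + exists t. split; [exact Ht|]. now rewrite Ep, E1, Cmult_1_l.
  - intros [t [Ht ->]].
    assert (Hc : in_cdisk (phi d (cis t))) by apply Cmod_phi_unit_le_1, Cmod_cis.
    split; [exact Hc|]. intros eps He. split.
    + destruct (phi_radial_limit d t eps He) as [u [Hu Hd]].
      exists (phi d u). split; [apply Etilde_phi; [exact hd|now exists u]|].
      split; [|exact Hd]. apply Rlt_le. now apply Cmod_phi_lt_1.
    (* The epicycloid point itself is the witness outside [Etilde]. *)
    + exists (phi d (cis t)). split; [exact Hc|]. split.
      * intros HE. apply Etilde_phi in HE; [|exact hd]. destruct HE as [u [Hu E]].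
        symmetry in E. revert E. apply phi_interior_neq_boundary; try assumption.
        apply Cmod_cis.
      * replace (phi d (cis t) - phi d (cis t))%C with (RtoC 0) by ring.
        now rewrite Cmod_0.
Qed.
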